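(* Let $K$ be a reproducing kernel on $\mathcal X$ with RKHS $\mathcal H_K$, and let $A:\mathcal H_1\to\mathcal H_2$ be the operator $(Af)(x)=\langle f,\phi_x\rangle_{\mathcal H_1}$. Let $g_{R_y}:=\arg\min_{g\in\mathcal H_K}R_y(g)$ be the solution of the approximation problem in $\mathcal H_K$, and let $f^\dagger_{R_y}$ be the $R_y$-generalized solution of the inverse problem $y=Af$, i.e. the element of minimum $\mathcal H_1$-norm in $\mathcal S_{A,R_y}:=\arg\min_{f\in\mathcal H_1}R_y(Af)$. If $K(x,x')=\langle\phi_x,\phi_{x'}\rangle_{\mathcal H_1}$ for all $x,x'\in\mathcal X$, then $$f^\dagger_{R_y}=\tilde A^{-1}g_{R_y}.$$
   Context: Setting. $\mathcal H_1$ is a real separable Hilbert space, $\mathcal X$ is a Borel space, $\mathcal H_2$ is a real Hilbert space of real-valued functions on $\mathcal X$, and $A:\mathcal H_1\to\mathcal H_2$ is a bounded linear operator for which there is a constant $c>0$ with $|(Af)(x)|\le c\|f\|_{\mathcal H_1}$ for all $x\in\mathcal X$, $f\in\mathcal H_1$. By Riesz' theorem, for every $x$ there is $\phi_x\in\mathcal H_1$ with $(Af)(x)=\langle f,\phi_x\rangle_{\mathcal H_1}$ for all $f$. $\Im(A)$ is the range of $A$. It is known that $\Im(A)$ with norm $\|g\|=\min\{\|w\|_{\mathcal H_1}: w\in\mathcal H_1,\ g(x)=\langle w,\phi_x\rangle_{\mathcal H_1}\ \forall x\in\mathcal X\}$ is the RKHS with kernel $\langle\phi_x,\phi_{x'}\rangle_{\mathcal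 H_1}$. $\tilde A:=A_{|Ker(A)^\perp}:Ker(A)^\perp\to\Im(A)$, which is a bijection with inverse $\tilde A^{-1}$. Hypotheses on the functional. $y\in\mathcal H_2$ and $\mathcal H_K\subseteq\mathcal H_2$. $R_y:\mathcal H_2\to\mathbb R$ satisfies $R_y(g)\ge0$ for all $g\in\mathcal H_2$, and $R_y(g)=0$ iff $g=y$. If $y\in\mathcal H_K$, $R_y$ is strictly convex. If $y\notin\mathcal H_K$, either (a) $R_y$ is lower semicontinuous, strictly convex and coercive with respect to $\|\cdot\|_{\mathcal H_2}$ and $\mathcal H_K$ is closed in $\mathcal H_2$, or (b) $R_y$ is (on $\mathcal H_K$) lower semicontinuous, strictly convex and coercive with respect to $\|\cdot\|_{\mathcal H_K}$. These hypotheses ensure that $g_{R_y}$ exists and is unique. *)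

(* Defs.v *)
From HB Require Import structures.
From mathcomp Require Import all_boot all_order all_algebra sesquilinear.
From mathcomp Require Import all_classical all_reals all_analysis.

Set Implicit Arguments.
Unset Strict Implicit.
Unset Printing Implicit Defensive.

Import Order.TTheory GRing.Theory Num.Theory.
Import numFieldNormedType.Exports.

Local Open Scope classical_set_scope.
Local Open Scope ring_scope.

(* Real Hilbert spaces: complete normed modules whose norm is induced by a
   symmetric positive definite bilinear form. *)
HB.mixin Record hasInner (R : realType) V of NormedModule R V := {
  inner : {dot V for (@idfun R)} ;
  inner_norm : forall u : V, inner u u = `|u| ^+ 2
}.

#[short(type="hilbertType")]
HB.structure Definition Hilbert (R : realType) :=
  {V of hasInner R V & CompleteNormedModule R V}.

(* A Hilbert space of real-valued functions on X is a Hilbert space together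
   with a linear evaluation map that identifies each vector with a genuine
   function X -> R (not a class modulo a null set).  Evaluation at a point is
   not required to be continuous. *)
HB.mixin Record hasEval (R : realType) (X : Type) V of NormedModule R V := {
  ev : V -> X -> R ;
  ev_linear : forall (a : R) (u v : V) x, ev (a *: u + v) x = a * ev u x + ev v x ;
  ev_inj : injective ev
}.

#[short(type="funHilbertType")]
HB.structure Definition FunHilbert (R : realType) (X : Type) :=
  {V of hasEval R X V & Hilbert R V}.

Definition separable (T : topologicalType) :=
  exists2 D : set T, countable D & dense D.

Definition is_rkhs (R : realType) (X : Type) (K : X -> X -> R)
    (HK : funHilbertType R X) :=
  forall x, exists2 k : HK, (forall x', ev k x' = K x' x) &
                            forall g : HK, ev g x = inner g k.

Definition strictly_convex (R : realType) (V : lmodType R) (F : V -> R) :=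
  forall (u v : V) (t : R), u != v -> 0 < t < 1 ->
    F (t *: u + (1 - t) *: v) < t * F u + (1 - t) * F v.

Definition coercive (R : realType) (V : normedModType R) (F : V -> R) :=
  forall M : R, exists r : R, forall u : V, r <= `|u| -> M <= F u.

Definition lsc (R : realType) (T : topologicalType) (F : T -> R) :=
  lower_semicontinuous (fun u => (F u)%:E).

Definition argmin (R : realType) (T : Type) (D : set T) (F : T -> R) : set T :=
  [set u | D u /\ forall v, D v -> F u <= F v].

(* [iota] is the inclusion of HK into H2; (i) is stated for the norm of H2 and
   (ii) for the norm of HK. *)
Definition data_fit (R : realType) (H2 HK : hilbertType R) (iota : HK -> H2)
    (y : H2) (Ry : H2 -> R) :=
  [/\ forall g, 0 <= Ry g,
      forall g, Ry g = 0 <-> g = y,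
      range iota y -> strictly_convex Ry &
      ~ range iota y ->
        [/\ lsc Ry, strictly_convex Ry, coercive Ry & closed (range iota)] \/
        [/\ lsc (Ry \o iota), strictly_convex (Ry \o iota)
          & coercive (Ry \o iota)]].

Definition ker (R : realType) (H1 H2 : hilbertType R) (A : H1 -> H2) : set H1 :=
  A @^-1` [set 0].

Definition orthocompl (R : realType) (H : hilbertType R) (E : set H) : set H :=
  [set u | forall v, E v -> inner u v = 0].

Definition generalized_solutions (R : realType) (H1 H2 : hilbertType R)
    (A : H1 -> H2) (Ry : H2 -> R) : set H1 :=
  argmin (argmin [set: H1] (Ry \o A)) (fun f => `|f|).

(* Inverse of the restriction of A to (Ker A)^perp; by convention it is 0
   outside the image of that restriction. *)
Definition Atilde_inv (R : realType) (H1 H2 : hilbertType R) (A : H1 -> H2) :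
    H2 -> H1 :=
  'pinv_(fun=> 0) (orthocompl (ker A)) A.

(* Main.v *)
Require Import Defs.
From HB Require Import structures.
From mathcomp Require Import all_boot all_order all_algebra sesquilinear.
From mathcomp Require Import all_classical all_reals all_analysis.
From mathcomp Require Import ring lra.

(** The theorem holds because the hypothesis on the kernel makes the two
    minimization problems run over the same functions: the inclusion of [HK]
    and the operator [A] have the same range in [H2] ([rkhs_eq_range]).

    Let [k x] be the representer of evaluation at [x] in [HK].  The families
    [phi] and [k] have the same Gram matrix, so a linear combination of the
    [phi x] and the one of the [k x] with the same coefficients have the same
    norm.  Given [u] on one side, project it on the closed span of its family,
    approximate the projection by combinations, and copy their coefficients to
    the other side: the copies are Cauchy, and their limit has the same inner
    products with its family as [u] with its own ([equal_gram_transfer]).  As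
    these inner products are the values of the functions [iota h] and [A f],
    every [iota h] is some [A f], and conversely.

    The fit [Ry] has exactly one minimizer [g] on this common range
    ([data_fit_argmin]): it is [y] itself if [y] is in the range, and otherwise
    it is given by the direct method, with the parallelogram law in the role
    of weak compactness: sublevel sets are closed, convex and bounded, and
    nearly minimal-norm points of a nested sequence of such sets form a
    Cauchy sequence ([nested_nonempty]).  The same existence result yields
    orthogonal projections, hence the bijectivity of [A] from the orthogonal
    complement of its kernel onto its range ([orthocompl_ker_bij]).

    The minimizers of [Ry \o A] thus form the fibre of [A] over [g].  This
    fibre is [f + ker A], where [f] is its only point orthogonal to [ker A],
    and by Pythagoras [f] is its only point of minimum norm
    ([orthocompl_ker_min_norm]). *)

Set Implicit Arguments.
Unset Strict Implicit.
Unset Printing Implicit Defensive.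

Import Order.TTheory GRing.Theory Num.Theory.
Import numFieldNormedType.Exports.

Local Open Scope classical_set_scope.
Local Open Scope ring_scope.

(** * Inner products *)

Lemma innerC (R : realType) (V : hilbertType R) (u v : V) :
  inner u v = inner v u.
Proof. by rewrite hermC expr0 mul1r. Qed.

Lemma sqr_normD (R : realType) (V : hilbertType R) (u v : V) :
  `|u + v| ^+ 2 = `|u| ^+ 2 + 2 * inner u v + `|v| ^+ 2.
Proof.
rewrite -!inner_norm linearDl !linearDr /= (innerC v u); ring.
Qed.

Lemma sqr_normB (R : realType) (V : hilbertType R) (u v : V) :
  `|u - v| ^+ 2 = `|u| ^+ 2 - 2 * inner u v + `|v| ^+ 2.
Proof. by rewrite sqr_normD normrN linearNr /= mulrN. Qed.

Lemma parallelogram (R : realType) (V : hilbertType R) (u v : V) :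
  `|u - v| ^+ 2 =
  2 * `|u| ^+ 2 + 2 * `|v| ^+ 2 - 4 * `|2^-1 *: (u + v)| ^+ 2.
Proof.
rewrite sqr_normB normrZ exprMn sqr_normD ger0_norm ?invr_ge0//.
by field.
Qed.

(** Cauchy-Schwarz; as the norm is already known to satisfy the triangle
    inequality, it suffices to square the latter. *)
Lemma normr_inner_le (R : realType) (V : hilbertType R) (u v : V) :
  `|inner u v| <= `|u| * `|v|.
Proof.
have main (w : V) : inner u w <= `|u| * `|w|.
  have : `|u + w| ^+ 2 <= (`|u| + `|w|) ^+ 2.
    by rewrite ler_sqr ?nnegrE ?addr_ge0// ler_normD.
  rewrite sqr_normD; nra.
rewrite ler_norml main andbT lerNl -linearNr.
by rewrite -(normrN v) main.
Qed.

Lemma cvg_innerl (R : realType) (V : hilbertType R) (T : Type)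
    (F : set_system T) {FF : Filter F} (s : T -> V) (u w : V) :
  s @ F --> u -> (fun t => inner (s t) w) @ F --> inner u w.
Proof.
move=> su; apply/cvgrPdist_lt => e e0.
have w0 : 0 < `|w| + 1 by rewrite ltr_wpDl.
have ew : 0 < e / (`|w| + 1) by rewrite divr_gt0.
move/cvgrPdist_lt : su => /(_ _ ew); apply: filterS => n.
rewrite ltr_pdivlMr// => h; rewrite -linearBl /=.
apply: le_lt_trans h; apply: (le_trans (normr_inner_le _ _)).
by rewrite ler_wpM2l// lerDl.
Qed.

Lemma closed_orthocompl (R : realType) (V : hilbertType R) (E : set V) :
  closed (orthocompl E).
Proof.
have -> : orthocompl E = \bigcap_(v in E) [set u | inner u v = 0] by [].
apply: closed_bigI => v _.
apply: (@closed_comp _ _ (fun u => inner u v) [set 0]).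
  by move=> u _; apply: cvg_innerl; exact: cvg_id.
exact: closed_eq.
Qed.

Lemma cauchy_seq_cvg (R : realType) (V : hilbertType R) (s : nat -> V) :
  (forall e, 0 < e -> exists N, forall m n, (N <= m)%N -> (N <= n)%N ->
     `|s m - s n| < e) -> cvg (s @ \oo).
Proof.
move=> h; apply/cauchy_cvgP/cauchyP => e e0.
have [N hN] := h _ e0; exists (s N).
by exists N => // n Nn; rewrite -ball_normE; exact: hN.
Qed.

(** * Minimizers of convex functionals *)

(** Midpoints are all that the parallelogram law sees, and for closed sets
    stability under midpoints amounts to convexity. *)
Definition midpoint_closed (R : realType) (V : lmodType R) (C : set V) :=
  forall u v, C u -> C v -> C (2^-1 *: (u + v)).

Lemma midpointxx (R : realType) (V : lmodType R) (u : V) :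
  2^-1 *: (u + u) = u.
Proof. by rewrite -{1 2}[u]scale1r -scalerDl scalerA mulVf ?scale1r. Qed.

(** This replaces weak compactness of bounded closed convex sets.  Choose
    [s n] in [C n] with almost minimal norm.  The squared norms, being
    almost nondecreasing and bounded, approach a supremum [Q]; for large [m]
    and [n] both [`|s m| ^+ 2] and [`|s n| ^+ 2] are close to [Q] while the
    midpoint, which lies in an early [C N], has squared norm not much smaller
    than [Q], so the parallelogram law bounds [`|s m - s n|]. *)
Lemma nested_nonempty (R : realType) (V : hilbertType R) (C : nat -> set V)
    (r : R) :
  (forall n, closed (C n)) -> (forall n, midpoint_closed (C n)) ->
  (forall n, C n !=set0) -> (forall m n, (m <= n)%N -> C n `<=` C m) ->
  (forall u, C 0 u -> `|u| <= r) ->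
  \bigcap_n C n !=set0.
Proof.
move=> Ccl Cmid C0 Cdec Cr.
have /choice[s sP] n : exists u, C n u /\
    forall v, C n v -> `|u| ^+ 2 - n.+1%:R^-1 <= `|v| ^+ 2.
  set S := [set `|u| ^+ 2 | u in C n].
  have Sinf : has_inf S.
    split; first by have [u Cu] := C0 n; exists (`|u| ^+ 2), u.
    by exists 0 => _ [u _ <-]; rewrite sqr_ge0.
  have n0 : 0 < n.+1%:R^-1 :> R by rewrite invr_gt0.
  have [_ [u Cu <-] ub] := inf_adherent n0 Sinf.
  exists u; split=> // v Cv; rewrite lerBlDr (le_trans (ltW ub))// lerD2r.
  by apply: ge_inf; [case: Sinf|exists v].
pose q n := `|s n| ^+ 2 - n.+1%:R^-1.
have qr n : q n <= r ^+ 2.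
  have Cs : C 0 (s n) by apply: (Cdec _ n) => //; case: (sP n).
  rewrite /q (@le_trans _ _ (`|s n| ^+ 2))//.
    by rewrite lerBlDr lerDl invr_ge0.
  rewrite ler_sqr ?nnegrE//; first exact: Cr.
  exact: le_trans (Cr _ Cs).
have qsup : has_sup (range q).
  by split; [exists (q 0), 0|exists (r ^+ 2) => _ [n _ <-]].
have [Q [qQ Qq]] : exists Q, (forall n, q n <= Q) /\
    forall e, 0 < e -> exists n, Q - e < q n.
  exists (sup (range q)); split=> [n|e e0].
    by apply: ub_le_sup; [case: qsup|exists n].
  by have [_ [n _ <-] ?] := sup_adherent e0 qsup; exists n.
have sc : cvg (s @ \oo).
  apply: cauchy_seq_cvg => e e0.
  have e8 : 0 < e ^+ 2 / 8 by rewrite divr_gt0// exprn_gt0.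
  have [N1 hN1] := Qq _ e8.
  have [N2 _ hN2] := near_infty_natSinv_lt (PosNum e8).
  exists (maxn N1 N2) => m n; rewrite !geq_max => /andP[m1 m2] /andP[n1 n2].
  rewrite -ltr_sqr ?nnegrE ?(ltW e0)// parallelogram.
  have Cs k : (N1 <= k)%N -> C N1 (s k).
    by move=> k1; apply: (Cdec _ k) => //; case: (sP k).
  have mid : q N1 <= `|2^-1 *: (s m + s n)| ^+ 2.
    by apply: (sP N1).2; apply: Cmid; apply: Cs.
  have := hN2 _ m2; have := hN2 _ n2; have := qQ m; have := qQ n.
  rewrite /= /q in mid hN1 *.
  (* The inverses have to be atoms for lra. *)
  move: (m.+1%:R^-1) (n.+1%:R^-1) (N1.+1%:R^-1) mid hN1 => ? ? ? ? ?.
  lra.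
exists (lim (s @ \oo)) => n _.
apply: (closed_cvg (C n) (Ccl n)) sc.
near=> k; apply: (Cdec _ k); last by case: (sP k).
by near: k; exact: nbhs_infty_ge.
Unshelve. all: by end_near. Qed.

(** The direct method: the sublevel sets of [F] at the heights
    [inf F + 1 / (n + 1)] are nested and, by coercivity, bounded; a point
    common to all of them is a minimizer. *)
Lemma argmin_nonempty (R : realType) (V : hilbertType R) (C : set V)
    (F : V -> R) :
  closed C -> midpoint_closed C -> C !=set0 ->
  (forall u, 0 <= F u) ->
  (forall a, closed [set u | F u <= a]) ->
  (forall a, midpoint_closed [set u | F u <= a]) ->
  coercive F -> argmin C F !=set0.
Proof.
move=> Ccl Cmid [c Cc] F0 Fcl Fmid Fco.
set S := [set F u | u in C].
have Sinf : has_inf S.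
  by split; [exists (F c), c|exists 0 => _ [u _ <-]].
set m := inf S.
have [r hr] := Fco (m + 2).
pose D n := C `&` [set u | F u <= m + n.+1%:R^-1].
have [|||||u Du] := @nested_nonempty R V D r.
- by move=> n; apply: closedI.
- by move=> n u v [Cu Fu] [Cv Fv]; split; [exact: Cmid|exact: Fmid].
- move=> n; have n0 : 0 < n.+1%:R^-1 :> R by rewrite invr_gt0.
  have [_ [u Cu <-] ub] := inf_adherent n0 Sinf.
  by exists u; split=> //; exact: ltW.
- move=> i j ij u [Cu Fu]; split=> //=; apply: (le_trans Fu).
  by rewrite lerD2l lef_pV2 ?posrE// ler_nat.
- move=> u [_ /= Fu]; rewrite leNgt; apply/negP => /ltW/hr.
  rewrite invr1 in Fu; lra.
exists u; split; first by case: (Du 0).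
move=> v Cv; apply: (@le_trans _ _ m); last first.
  by apply: ge_inf; [case: Sinf|exists v].
apply/ler_addgt0Pr => e e0.
have [N _ hN] := near_infty_natSinv_lt (PosNum e0).
have [_ /= FN] := Du N I; apply: (le_trans FN); rewrite lerD2l.
exact: ltW (hN N (leqnn N)).
Qed.

Lemma strictly_convex_midpoint (R : realType) (V : lmodType R) (F : V -> R)
    (u v : V) :
  strictly_convex F -> u != v -> F (2^-1 *: (u + v)) < 2^-1 * (F u + F v).
Proof.
move=> cF uv; have := cF u v 2^-1 uv.
have -> : 1 - 2^-1 = 2^-1 :> R by field.
by rewrite -scalerDr -mulrDr; apply; lra.
Qed.

Lemma argmin_strictly_convex (R : realType) (V : hilbertType R) (C : set V)
    (F : V -> R) :
  closed C -> midpoint_closed C -> C !=set0 ->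
  (forall u, 0 <= F u) -> lsc F -> strictly_convex F -> coercive F ->
  exists u, argmin C F = [set u].
Proof.
move=> Ccl Cmid Cn0 F0 Fl Fc Fco.
have [||u uF] := @argmin_nonempty R V C F Ccl Cmid Cn0 F0 _ _ Fco.
- move=> a; have -> : [set u | F u <= a] = ~` [set u | (a%:E < (F u)%:E)%E].
    apply/seteqP; split=> u /=; rewrite lte_fin; first by rewrite leNgt => /negP.
    by move/negP; rewrite -leNgt.
  by apply: open_closedC; move/lower_semicontinuousP : Fl; exact.
- move=> a u v /= Fu Fv; have [->|uv] := eqVneq u v.
    by rewrite midpointxx.
  by have := strictly_convex_midpoint Fc uv; lra.
exists u; apply/seteqP; split=> [v vF|_ ->//] /=.
apply/eqP/negPn/negP => vu.
have := strictly_convex_midpoint Fc vu.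
have [Cu Fu] := uF; have [Cv Fv] := vF.
have := Fu _ Cv; have := Fv _ Cu; have := Fu _ (Cmid _ _ Cv Cu).
lra.
Qed.

(** * Orthogonal projection *)

Definition subspace (R : realType) (V : lmodType R) (W : set V) :=
  forall a u v, W u -> W v -> W (a *: u + v).

(** The projection is the nearest point [w] of [W]. For [v] in [W], replacing
    [w] by [w + t *: v] cannot shorten [x - w], and a quadratic polynomial
    in [t] that is nonnegative and vanishes at [0] has no linear term. *)
Lemma orthogonal_projection (R : realType) (V : hilbertType R) (W : set V)
    (x : V) :
  closed W -> W 0 -> subspace W ->
  exists2 w, W w & orthocompl W (x - w).
Proof.
move=> Wcl W0 Wlin.
have [||||||w [Ww wmin]] := @argmin_nonempty R V W (fun u => `|x - u|) Wcl.
- move=> u v Wu Wv; rewrite -[_ *: _]addr0; apply: (Wlin) => //.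
  by rewrite -[u]scale1r; exact: Wlin.
- by exists 0.
- by move=> u; exact: normr_ge0.
- move=> a; apply: (@closed_comp _ _ (fun u => `|x - u|) [set t | t <= a]).
    by move=> u _; apply: cvg_norm; apply: cvgB; [exact: cvg_cst|exact: cvg_id].
  exact: closed_le.
- move=> a u v /= ua va.
  have -> : x - 2^-1 *: (u + v) = 2^-1 *: ((x - u) + (x - v)).
    rewrite addrACA -opprD scalerBr; congr (_ - _).
    by rewrite midpointxx.
  rewrite normrZ ger0_norm ?invr_ge0//.
  by have := ler_normD (x - u) (x - v); lra.
- move=> M; exists (M + `|x|) => u; rewrite -lerBrDr => /le_trans; apply.
  by rewrite distrC lerB_dist.
exists w => // v Wv; set b := inner _ _.
have key t : 0 <= t ^+ 2 * `|v| ^+ 2 - 2 * (t * b).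
  have := wmin (t *: v + w) (Wlin _ _ _ Wv Ww).
  rewrite -ler_sqr ?nnegrE//.
  have -> : x - (t *: v + w) = (x - w) - t *: v by rewrite opprD addrA addrAC.
  rewrite (sqr_normB (x - w)) normrZ exprMn linearZr /= -/b.
  rewrite real_normK ?num_real//; lra.
have s0 : 0 < `|v| ^+ 2 + 1 by rewrite ltr_wpDl ?sqr_ge0.
(* The optimal t is b / |v|^2; the added 1 avoids a separate case v = 0. *)
have := key (b / (`|v| ^+ 2 + 1)).
move: s0 (sqr_ge0 `|v|); set s := `|v| ^+ 2 => s0 sge0.
have -> : (b / (s + 1)) ^+ 2 * s - 2 * (b / (s + 1) * b) =
   - (b ^+ 2 * ((s + 2) / (s + 1) ^+ 2)) by field; rewrite gt_eqF.
rewrite oppr_ge0 pmulr_lle0; last by rewrite divr_gt0 ?exprn_gt0//; lra.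
by move=> b2; apply/eqP; rewrite -sqrf_eq0 eq_le b2 sqr_ge0.
Qed.

(** * Families with the same Gram matrix *)

Definition lincomb (R : realType) (X : Type) (V : lmodType R) (p : X -> V)
  (s : seq (R * X)) : V := \sum_(i <- s) i.1 *: p i.2.

Lemma inner_lincomb (R : realType) (X : Type) (V : hilbertType R) (p : X -> V)
    (s : seq (R * X)) (v : V) :
  inner (lincomb p s) v = \sum_(i <- s) i.1 * inner (p i.2) v.
Proof.
rewrite /lincomb; elim: s => [|i s IH]; first by rewrite !big_nil linear0l.
by rewrite !big_cons linearDl linearZl_LR /= IH.
Qed.

Lemma span_closure_subspace (R : realType) (X : Type) (V : hilbertType R)
    (p : X -> V) :
  subspace (closure (range (lincomb p))).
Proof.
have ap u : closure (range (lincomb p)) u <->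
    forall e, 0 < e -> exists s, `|u - lincomb p s| < e.
  split=> [cu e e0|h B /nbhs_ballP[e e0 eB]].
    have [_ [[s _ <-] us]] := cu _ (nbhsx_ballx u e e0).
    by exists s; rewrite -ball_normE in us.
  have [s us] := h e e0; exists (lincomb p s); split; first by exists s.
  by apply: eB; rewrite -ball_normE.
move=> a u v /ap cu /ap cv; apply/ap => e e0.
have a0 : 0 < `|a| + 1 by rewrite ltr_wpDl.
have [|s us] := cu (e / 2 / (`|a| + 1)); first by rewrite !divr_gt0.
have [|t vt] := cv (e / 2); first by rewrite divr_gt0.
exists ([seq (a * i.1, i.2) | i <- s] ++ t).
have -> : lincomb p ([seq (a * i.1, i.2) | i <- s] ++ t) =
   a *: lincomb p s + lincomb p t.
  rewrite /lincomb big_cat big_map scaler_sumr; congr (_ + _).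
  by apply: eq_bigr => i _; rewrite scalerA.
rewrite opprD addrACA -scalerBr (le_lt_trans (ler_normD _ _))// normrZ.
move: us; rewrite ltr_pdivlMr// => us.
have := normr_ge0 (u - lincomb p s); nra.
Qed.

(** The partial isometry sending [p x] to [q x] carries the projection of [u]
    on the closed span of [p] to the required [v].  It is never built as a
    map: only its value at this projection is obtained, as the limit of the
    combinations [lincomb q (s n)], where [lincomb p (s n)] converges to the
    projection. *)
Lemma equal_gram_transfer (R : realType) (X : Type) (V V' : hilbertType R)
    (p : X -> V) (q : X -> V') (u : V) :
  (forall x x', inner (p x) (p x') = inner (q x) (q x')) ->
  exists v, forall x, inner v (q x) = inner u (p x).
Proof.
move=> pq; set W := closure (range (lincomb p)).
have Wp x : W (p x).
  by apply: subset_closure; exists [:: (1, x)] => //;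
    rewrite /lincomb big_seq1 scale1r.
have W0 : W 0.
  by apply: subset_closure; exists [::] => //; rewrite /lincomb big_nil.
have [u0 Wu0 uu0] := @orthogonal_projection R V W u (@closed_closure _ _) W0
  (@span_closure_subspace R X V p).
have /choice[s sP] (n : nat) : exists s, `|u0 - lincomb p s| < n.+1%:R^-1.
  have n0 : 0 < n.+1%:R^-1 :> R by rewrite invr_gt0.
  have [_ [[s _ <-] us]] := Wu0 _ (nbhsx_ballx u0 _ n0).
  by exists s; rewrite -ball_normE in us.
have cp : (fun n => lincomb p (s n)) @ \oo --> u0.
  apply/cvgrPdist_lt => e e0.
  have := near_infty_natSinv_lt (PosNum e0).
  by apply: filterS => n; exact: lt_trans.
have ipq a x : inner (lincomb p a) (p x) = inner (lincomb q a) (q x).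
  by rewrite !inner_lincomb; apply: eq_bigr => i _; rewrite pq.
have iso a b : inner (lincomb p a) (lincomb p b) =
               inner (lincomb q a) (lincomb q b).
  rewrite !inner_lincomb; apply: eq_bigr => i _; congr (_ * _).
  by rewrite innerC ipq innerC.
have cq : cvg ((fun n => lincomb q (s n)) @ \oo).
  apply: cauchy_seq_cvg => e e0.
  have e2 : 0 < e / 2 by rewrite divr_gt0.
  have [N _ hN] := near_infty_natSinv_lt (PosNum e2).
  exists N => m n Nm Nn.
  have -> : `|lincomb q (s m) - lincomb q (s n)| =
            `|lincomb p (s m) - lincomb p (s n)|.
    apply/eqP; rewrite -(@eqrXn2 _ 2)//.
    by rewrite !sqr_normB -!inner_norm !iso.
  have := hN _ Nm; have := hN _ Nn; have := sP m; have := sP n => /=.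
  have := ler_distD u0 (lincomb p (s m)) (lincomb p (s n)).
  rewrite (distrC (lincomb p (s m)) u0).
  by move: (m.+1%:R^-1) (n.+1%:R^-1) => ? ?; lra.
exists (lim ((fun n => lincomb q (s n)) @ \oo)) => x.
have -> : inner u (p x) = inner u0 (p x).
  by apply/eqP; rewrite -subr_eq0 -linearBl /= uu0.
apply: (norm_cvg_unique (cvg_innerl (w := q x) cq)).
rewrite /= -(funext (fun n => ipq (s n) x)); exact: cvg_innerl.
Qed.

(** * Application to the operator *)

Lemma ev_ext (R : realType) (X : Type) (V : funHilbertType R X) (u v : V) :
  (forall x, ev u x = ev v x) -> u = v.
Proof. by move=> uv; apply: ev_inj; apply/funext. Qed.

(** Both sides consist of the functions that have the form
    [fun x => inner u (p x)], with [p := phi] for the range of [A] and with [p]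
    the representers of evaluation for the range of [iota]; by the reproducing
    property these two families have the same Gram matrix. *)
Lemma rkhs_eq_range (R : realType) (X : Type) (H1 : hilbertType R)
    (H2 HK : funHilbertType R X) (A : H1 -> H2) (phi : X -> H1)
    (K : X -> X -> R) (iota : HK -> H2) :
  (forall f x, ev (A f) x = inner f (phi x)) ->
  (forall h x, ev (iota h) x = ev h x) ->
  is_rkhs K HK -> (forall x x', K x x' = inner (phi x) (phi x')) ->
  range iota = range A.
Proof.
move=> phiP iotaP HK_rkhs K_phi.
have /choice[k kP] x : exists k : HK, (forall x', ev k x' = K x' x) /\
    forall g : HK, ev g x = inner g k.
  by have [k kK kr] := HK_rkhs x; exists k.
have gram x x' : inner (k x) (k x') = inner (phi x) (phi x').
  by rewrite -(kP x').2 (kP x).1 K_phi innerC.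
apply/seteqP; split=> _ [u _ <-].
  have [f fP] := equal_gram_transfer u gram.
  by exists f => //; apply: ev_ext => x; rewrite phiP fP iotaP (kP x).2.
have [h hP] := equal_gram_transfer u (fun x x' => esym (gram x x')).
by exists h => //; apply: ev_ext => x; rewrite phiP -hP iotaP (kP x).2.
Qed.

(** If [y] is attained, it is the only zero of [Ry >= 0].  Otherwise the direct
    method applies, to the range of [iota] in [H2] when that range is closed,
    and in [HK] itself when the regularity is in terms of its norm. *)
Lemma data_fit_argmin (R : realType) (H2 HK : hilbertType R) (iota : HK -> H2)
    (y : H2) (Ry : H2 -> R) :
  linear iota -> data_fit iota y Ry ->
  exists g, argmin (range iota) Ry = [set g].
Proof.
move=> iota_lin [Ry0 Ryy _ Ryn].
have iotaM (u v : HK) : iota (2^-1 *: (u + v)) = 2^-1 *: (iota u + iota v).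
  have iota0 : iota 0 = 0.
    by have := iota_lin (-1) 0 0; rewrite scaler0 addr0 scaleN1r addNr.
  rewrite -[_ *: _]addr0 iota_lin iota0 addr0.
  by rewrite -{1}[u]scale1r iota_lin scale1r.
have [yr|/Ryn[[Rl Rc Rco icl]|[Rl Rc Rco]]] := pselect (range iota y).
- exists y; apply/seteqP; split=> [g [_ gm]|_ ->] /=.
    apply/Ryy/eqP; rewrite eq_le Ry0 andbT.
    by rewrite -((Ryy y).2 erefl) gm.
  by split=> // v _; rewrite (Ryy y).2.
- apply: argmin_strictly_convex => //.
    move=> _ _ [u _ <-] [v _ <-].
    by exists (2^-1 *: (u + v)).
  by exists (iota 0), 0.
- have [|||||||h hP] := @argmin_strictly_convex R HK setT (Ry \o iota).
  + exact: closedT.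
  + by [].
  + by exists 0.
  + by move=> u; exact: Ry0.
  + by [].
  + by [].
  + by [].
  have [_ hm] : argmin setT (Ry \o iota) h by rewrite hP.
  exists (iota h); apply/seteqP; split=> [_ [[u _ <-] um]|_ ->] /=.
    suff : argmin setT (Ry \o iota) u by rewrite hP => ->.
    by split=> // v _; apply: um; exists v.
  by split; [exists h|move=> _ [v _ <-]; exact: hm].
Qed.

(** A preimage is moved into the orthogonal complement of the kernel by
    subtracting its projection on the kernel. *)
Lemma orthocompl_ker_bij (R : realType) (H1 H2 : hilbertType R)
    (A : {linear H1 -> H2}) :
  closed (ker A) -> set_bij (orthocompl (ker A)) (range A) A.
Proof.
move=> Acl; split=> [f _|f g|_ [f _ <-]]; first by exists f.
  rewrite !inE => fp gp Afg; apply/eqP; rewrite -subr_eq0 -normr_eq0.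
  have kfg : ker A (f - g) by rewrite /ker /= linearB Afg subrr.
  by rewrite -sqrf_eq0 -inner_norm linearBl /= fp// gp// subrr.
have [||w kw fw] := orthogonal_projection f Acl.
- by rewrite /ker /= linear0.
- by move=> a u v /= Au Av; rewrite /ker /= linearP Au Av scaler0 addr0.
by exists (f - w) => //; rewrite linearB kw subr0.
Qed.

(** The points of the fibre differ from [f] by elements of the kernel, which are
    orthogonal to [f], so Pythagoras applies. *)
Lemma orthocompl_ker_min_norm (R : realType) (H1 H2 : hilbertType R)
    (A : {linear H1 -> H2}) (f : H1) :
  orthocompl (ker A) f ->
  argmin (A @^-1` [set A f]) (fun u => `|u|) = [set f].
Proof.
move=> fp.
have pyth u : A u = A f -> `|u| ^+ 2 = `|f| ^+ 2 + `|u - f| ^+ 2.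
  move=> Auf; have kuf : ker A (u - f) by rewrite /ker /= linearB Auf subrr.
  by rewrite -{1}[u](subrKC f) sqr_normD fp// mulr0 addr0.
apply/seteqP; split=> [u [Auf um]|_ ->] /=.
  have : `|u| ^+ 2 <= `|f| ^+ 2 by rewrite ler_sqr ?nnegrE//; exact: um.
  rewrite (pyth u)// gerDl => uf0; apply/eqP; rewrite -subr_eq0 -normr_eq0.
  by rewrite -sqrf_eq0 eq_le uf0 sqr_ge0.
split=> // u Auf; rewrite -ler_sqr ?nnegrE// (pyth u)// lerDl.
exact: sqr_ge0.
Qed.

Unset Implicit Arguments.

Theorem theorem1 (R : realType) (d : measure_display) (X : measurableType d)
    (H1 : hilbertType R) (H1_sep : separable H1)
    (H2 : funHilbertType R X)
    (A : {linear H1 -> H2})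
    (A_bounded : exists M : R, forall f : H1, `|A f| <= M * `|f|)
    (A_ev_bounded : exists2 c : R, 0 < c &
       forall (x : X) (f : H1), `|ev (A f) x| <= c * `|f|)
    (phi : X -> H1)
    (phiP : forall (f : H1) (x : X), ev (A f) x = inner f (phi x))
    (K : X -> X -> R)
    (HK : funHilbertType R X) (HK_rkhs : is_rkhs K HK)
    (iota : HK -> H2)
    (iotaP : forall (h : HK) (x : X), ev (iota h) x = ev h x)
    (y : H2) (Ry : H2 -> R) (RyP : data_fit iota y Ry)
    (K_phi : forall x x' : X, K x x' = inner (phi x) (phi x')) :
  set_bij (orthocompl (ker A)) (range A) A /\
  exists (gRy : H2) (fdag : H1),
    [/\ argmin (range iota) Ry = [set gRy],
        generalized_solutions A Ry = [set fdag],
        range A gRy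
      & fdag = Atilde_inv A gRy].
Proof.
have rangeE := rkhs_eq_range phiP iotaP HK_rkhs K_phi.
(* Closedness of the kernel is read off from its description as an orthogonal
   complement. *)
have kerE : ker A = orthocompl (range phi).
  apply/seteqP; split=> f fP.
    by move=> _ [x _ <-]; rewrite -phiP fP -(linear0 A) phiP linear0l.
  rewrite /ker /= -(linear0 A); apply: ev_ext => x.
  by rewrite !phiP linear0l fP//; exists x.
have bijA : set_bij (orthocompl (ker A)) (range A) A.
  by apply: orthocompl_ker_bij; rewrite kerE; exact: closed_orthocompl.
split=> //.
have iota_lin : linear iota.
  by move=> a u v; apply: ev_ext => x; rewrite ev_linear !iotaP ev_linear.
have [g gP] := data_fit_argmin iota_lin RyP.
have [gr _] : argmin (range iota) Ry g by rewrite gP.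
rewrite rangeE in gr gP.
have [_ injA surjA] := bijA.
have [f fp Afg] := surjA _ gr.
exists g, f; split=> //; first by rewrite rangeE.
  rewrite /generalized_solutions.
  have -> : argmin setT (Ry \o A) = A @^-1` [set A f].
    rewrite Afg -gP; apply/seteqP; split=> u.
      by move=> [_ um]; split; [exists u|move=> _ [v _ <-]; exact: um].
    by move=> [_ um]; split=> // v _; apply: um; exists v.
  exact: orthocompl_ker_min_norm.
by rewrite /Atilde_inv -Afg pinvKV// inE.
Qed.
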